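(* Let $(H,\circ)$ be a hypersemigroup. Then $H$ is regular if and only if, for every fuzzy subset $f$ of $H$, we have $f\preceq f\circ 1\circ f$.
   Context: Let $\mathcal{P}^*(H)$ denote the set of nonempty subsets of $H$. A hypergroupoid is a nonempty set $H$ with a hyperoperation $\circ: H\times H\to \mathcal{P}^*(H)$, $(a,b)\mapsto a\circ b$; it induces an operation $*$ on $\mathcal{P}^*(H)$ by $A*B=\bigcup_{(a,b)\in A\times B}(a\circ b)$. A hypersemigroup is a hypergroupoid $H$ such that $(x\circ y)*\{z\}=\{x\}*(y\circ z)$ for all $x,y,z\in H$. A hypersemigroup $H$ is called regular if for every $a\in H$ there exists $x\in H$ such that $a\in (a\circ x)*\{a\}$. A fuzzy subset of $H$ is a mapping $f:H\to[0,1]$ into the real closed unit interval. For $a\in H$ put $A_a=\{(y,z)\in H\times H\mid a\in y\circ z\}$. For fuzzy subsets $f,g$ of $H$, the fuzzy subset $f\circ g$ of $H$ is defined by $(f\circ g)(a)=\sup_{(y,z)\in A_a}\min\{f(y),g(z)\}$ if $A_a\neq\emptyset$, and $(f\circ g)(a)=0$ if $A_a=\emptyset$. (The same symbol $\circ$ is used for the hyperoperation on $H$ and the product of fuzzy subsets.) When $H$ is a hypersemigroup this product of fuzzy subsets is associative, so iterated products are written without parentheses. The order on fuzzy subsets is $f\preceq g$ if and only if $f(x)\le g(x)$ for every $x\in H$. The symbol $1$ denotes the fuzzy subset of $H$ with $1(x)=1$ for every $x\in H$. *)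

(* Defs.v *)
From mathcomp Require Import all_boot all_order all_algebra interval_inference.
From mathcomp Require Import boolp classical_sets reals.

Set Implicit Arguments.
Unset Strict Implicit.
Unset Printing Implicit Defensive.

Import Order.TTheory GRing.Theory Num.Theory.
Local Open Scope classical_set_scope.
Local Open Scope ring_scope.

(* A hyperoperation with values in the nonempty subsets of H is given by a
   set-valued map together with the nonemptiness of its values. *)
Record hypergroupoid := Hypergroupoid {
  carrier :> Type;
  carrier_neq0 : [set: carrier] !=set0;
  hop : carrier -> carrier -> set carrier;
  hop_neq0 : forall a b, hop a b !=set0 }.

(* The operation induced by hop on subsets; by set_hop_neq0 it restricts to
   the nonempty subsets. *)
Definition set_hop (H : hypergroupoid) (A B : set H) : set H :=
  \bigcup_(p in A `*` B) hop p.1 p.2.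

Lemma set_hop_neq0 (H : hypergroupoid) (A B : set H) :
  A !=set0 -> B !=set0 -> set_hop A B !=set0.
Proof.
by move=> [a Aa] [b Bb]; have [c abc] := hop_neq0 a b; exists c, (a, b).
Qed.

Record hypersemigroup := Hypersemigroup {
  hypersemigroup_base :> hypergroupoid;
  hopA : forall x y z : hypersemigroup_base,
    set_hop (hop x y) [set z] = set_hop [set x] (hop y z) }.

Definition regular (H : hypersemigroup) : Prop :=
  forall a : H, exists x : H, set_hop (hop a x) [set a] a.

Definition fuzzy_subset (R : realType) (H : Type) := H -> {i01 R}.

Section FuzzyProduct.
Variables (R : realType) (H : hypergroupoid).
Implicit Types f g : fuzzy_subset R H.

(* The set A_a of pairs whose hyperproduct contains a. *)
Definition factor_pairs (a : H) : set (H * H) := [set p | hop p.1 p.2 a].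

Definition fuzzy_mul_val f g (a : H) : R :=
  if `[< factor_pairs a !=set0 >]
  then sup [set Num.min (f p.1)%:num (g p.2)%:num | p in factor_pairs a]
  else 0.

Lemma fuzzy_mul_val_ge0 f g a : 0 <= fuzzy_mul_val f g a.
Proof.
rewrite /fuzzy_mul_val; case: asboolP => // -[p Ap].
apply: (@le_trans _ _ (Num.min (f p.1)%:num (g p.2)%:num)).
  by rewrite le_min !ge0.
apply: ub_le_sup; last by exists p.
by exists 1 => _ [q _ <-]; rewrite ge_min le1.
Qed.

Lemma fuzzy_mul_val_le1 f g a : fuzzy_mul_val f g a <= 1.
Proof.
rewrite /fuzzy_mul_val; case: asboolP => // -[p Ap].
apply: ge_sup; first by exists (Num.min (f p.1)%:num (g p.2)%:num), p.
by move=> _ [q _ <-]; rewrite ge_min le1.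
Qed.

(* Associative when H is a hypersemigroup, so the bracketing of an iterated
   product is immaterial there. *)
Definition fuzzy_mul f g : fuzzy_subset R H :=
  fun a => Itv01 (fuzzy_mul_val_ge0 f g a) (fuzzy_mul_val_le1 f g a).

Definition fuzzy_le f g : Prop := forall x, (f x)%:num <= (g x)%:num.

Definition fuzzy_one : fuzzy_subset R H := fun=> 1%:i01.

End FuzzyProduct.

Arguments fuzzy_one {R H}.

(* Main.v *)
Require Import Defs.
From mathcomp Require Import all_boot all_order all_algebra interval_inference.
From mathcomp Require Import boolp classical_sets reals.

(** Regularity at [a] unfolds to two memberships, [y \in a o x] and
    [a \in y o a].  The value of [f o 1 o f] at [a] is a supremum over pairs of
    memberships [y \in u o v], [a \in y o z] of the minimum of [f u] and [f z].

    If [H] is regular, the choice [u = z = a] is available, so the supremum is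
    at least [f a] ([fuzzy_mul_ge], used twice).

    Conversely, let [f] be the characteristic function of the singleton [a].
    Then [f o 1 o f] takes the value 1 at [a], so some term of the supremum is
    positive ([fuzzy_mul_gt], used twice); positivity of [f u] and of [f z]
    forces [u = z = a], which is regularity at [a]. *)

Import Order.TTheory GRing.Theory Num.Theory.
Local Open Scope classical_set_scope.
Local Open Scope ring_scope.

Lemma fuzzy_mul_ge (R : realType) (H : hypergroupoid)
    (f g : fuzzy_subset R H) (a y z : H) :
  hop y z a -> Num.min (f y)%:num (g z)%:num <= (fuzzy_mul f g a)%:num.
Proof.
move=> yza; rewrite /= /fuzzy_mul_val; case: asboolP => [_|[]]; last first.
  by exists (y, z).
apply: ub_le_sup; last by exists (y, z).
by exists 1 => _ [q _ <-]; rewrite ge_min le1.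
Qed.

(** The supremum need not be attained, but a strict lower bound on it is
    exceeded by some term.  Nonnegativity of [r] excludes the case where [a] has
    no factorization and the product is 0 by convention. *)
Lemma fuzzy_mul_gt (R : realType) (H : hypergroupoid)
    (f g : fuzzy_subset R H) (a : H) (r : R) :
  0 <= r -> r < (fuzzy_mul f g a)%:num ->
  exists y z : H, [/\ hop y z a, r < (f y)%:num & r < (g z)%:num].
Proof.
move=> r0; rewrite /= /fuzzy_mul_val; case: asboolP => [[p Ap]|_]; last first.
  by rewrite ltNge r0.
case/sup_gt; first by exists (Num.min (f p.1)%:num (g p.2)%:num), p.
by move=> _ [[y z] yza <-]; rewrite lt_min => /andP[ry rz]; exists y, z.
Qed.

Definition fuzzy_point (R : realType) (H : Type) (a : H) : fuzzy_subset R H :=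
  fun x => if `[< x = a >] then 1%:i01 else 0%:i01.

Lemma fuzzy_point_gt0 (R : realType) (H : Type) (a x : H) :
  0 < (fuzzy_point R H a x)%:num -> x = a.
Proof. by rewrite /fuzzy_point; case: asboolP => //= _; rewrite ltxx. Qed.

Lemma mem_set_hop1r (H : hypergroupoid) (A : set H) (a b : H) :
  set_hop A [set b] a <-> exists2 y, A y & hop y b a.
Proof.
split=> [[[y z] [/= Ay ->] yba]|[y Ay yba]]; first by exists y.
by exists (y, b).
Qed.

Theorem theorem5 (R : realType) (H : hypersemigroup) :
  regular H <->
  forall f : fuzzy_subset R H,
    fuzzy_le f (fuzzy_mul (fuzzy_mul f fuzzy_one) f).
Proof.
split=> [regH f a|leH a].
  have [x /mem_set_hop1r[y axy yaa]] := regH a.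
  apply: le_trans (fuzzy_mul_ge _ _ _ _ _ _ _ yaa).
  rewrite le_min lexx andbT.
  apply: le_trans (fuzzy_mul_ge _ _ _ _ _ _ _ axy).
  by rewrite le_min lexx le1.
have gt0 := leH (fuzzy_point R H a) a.
have {gt0} : 0 < (fuzzy_mul (fuzzy_mul (fuzzy_point R H a) fuzzy_one)
                            (fuzzy_point R H a) a)%:num.
  by apply: lt_le_trans gt0; rewrite /fuzzy_point asboolT //= ltr01.
move=> /(fuzzy_mul_gt _ _ _ _ _ _ (lexx _)) [y [z [yza y_gt0 z_gt0]]].
have [u [x [uxy u_gt0 _]]] := fuzzy_mul_gt _ _ _ _ _ _ (lexx _) y_gt0.
rewrite (fuzzy_point_gt0 _ _ _ _ z_gt0) in yza.
rewrite (fuzzy_point_gt0 _ _ _ _ u_gt0) in uxy.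
by exists x; apply/mem_set_hop1r; exists y.
Qed.
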